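(* There is an absolute constant $\omega>0$ such that for any integers $1<m\le n$ and any $n\times n$ symmetric complex matrix $Z=(z_{ij})$ satisfying $$|z_{ij}-1|\ \le\ \frac{\omega}{m-1}\quad\text{for all } i,j,$$ one has $P_m(Z)\neq 0$. One can choose $\omega=0.061$; and if $m\ge 10$ and $n\ge 4m$, one can choose $\omega=0.181$.
   Context: For an $n\times n$ symmetric matrix $Z=(z_{ij})$ and an integer $1<m\le n$, the partition function of cliques is $$P_m(Z)=\sum_{\substack{S\subset\{1,\ldots,n\}\\ |S|=m}}\ \prod_{\substack{\{i,j\}\subset S\\ i\ne j}} z_{ij},$$ where the product is over all unordered pairs of distinct elements of $S$. *)

(* Defs.v *)
From HB Require Import structures.
From mathcomp Require Export all_boot all_order all_algebra.
From mathcomp Require Export reals complex.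

Set Implicit Arguments.
Unset Strict Implicit.
Unset Printing Implicit Defensive.

Import Order.TTheory GRing.Theory Num.Theory.
Local Open Scope ring_scope.

(* An unordered pair {i, j} of distinct indices is represented by the pair
   (i, j) with i < j; the choice is immaterial since Z is meant to be symmetric. *)
Definition clique_partition (K : comNzRingType) (n m : nat) (Z : 'M[K]_n) : K :=
  \sum_(S : {set 'I_n} | #|S| == m)
    \prod_(p : 'I_n * 'I_n | [&& p.1 \in S, p.2 \in S & (p.1 < p.2)%N])
      Z p.1 p.2.

(* Main.v *)
Require Import Defs.
From mathcomp Require Import all_boot all_order all_algebra.
From mathcomp Require Import reals complex.
From mathcomp Require Import polyrcf ring lra.

(** Fix m and write P(V, O) for the sum of the weights of the cliques S of size
    m with O <= S <= V; the theorem is about P(V, O) with V everything and O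
    empty. Double counting gives (m - |O|) P(V, O) as the sum of P(V, O + l)
    over the vertices l of V outside O. So it is enough to know that these
    summands never cancel, and for this that any two of them differ by at most
    half of either modulus ([pins_close]): then the modulus of the sum is at
    least 37/40 of the sum of the moduli ([sum_normc_le]), and P(V, O) is
    nonzero as soon as one P(V, O + l) is.

    Closeness of the pins is proved by descending induction on |O|
    ([pins_close_step]). Write P(V, O + i) = A_i + B and P(V, O + j) = A_j + B,
    where B gathers the cliques through both i and j. Giving i the row of j
    turns A_i into A_j ([pinned_partition_swap]). Along the straight path
    between the two rows, the derivative of the value is a sum over l of values
    with the extra pin l, weighted by relative variations of the entries of at
    most 2 delta / (1 - delta). By the induction hypothesis and the sector
    bound, the modulus of this sum is at most 2/5 of that of the value itself
    ([change_row]), and Gronwall's inequality yields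
    |A_i - A_j| <= |A_j| / 2 because exp(2/5) < 3/2
    ([normc_increment_le]). Finally |A_j| <= |A_j + B|: the induction
    hypothesis also shows that A_j + B has a component of at least |B| / 2 in
    the direction of B ([avoid_pin_le]). *)

Set Implicit Arguments.
Unset Strict Implicit.
Unset Printing Implicit Defensive.

Import Order.TTheory GRing.Theory Num.Theory.
Import Normc.
Local Open Scope ring_scope.
Local Open Scope complex_scope.

(** * Partition functions with pinned vertices *)

Section PinnedPartition.
Variables (K : comNzRingType) (n : nat).
Implicit Types (Z : 'M[K]_n) (V O S T : {set 'I_n}) (i j l : 'I_n).

Definition clique_weight Z S : K :=
  \prod_(p : 'I_n * 'I_n | [&& p.1 \in S, p.2 \in S & (p.1 < p.2)%N])
    Z p.1 p.2.

(** The set O of pins is the induction parameter; the ambient set V shrinks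
    when two pins are compared, since the cliques through both are set aside. *)
Definition pinned_partition m Z V O : K :=
  \sum_(S : {set 'I_n} | [&& O \subset S, S \subset V & #|S| == m])
    clique_weight Z S.

(** Column i is replaced together with row i, so that symmetry is kept. *)
Definition set_row Z i (x : 'I_n -> K) : 'M[K]_n :=
  \matrix_(j, l) (if j == i then x l else if l == i then x j else Z j l).

Lemma set_row_sym Z i x : Z^T = Z -> (set_row Z i x)^T = set_row Z i x.
Proof.
move=> Zs; apply/matrixP=> j l; rewrite !mxE.
case: eqP => [li|_]; case: eqP => [ji|_] //; first by rewrite li ji.
by rewrite -{1}Zs mxE.
Qed.

Lemma set_rowE Z i x l : set_row Z i x i l = x l.
Proof. by rewrite mxE eqxx. Qed.

Lemma eq_set_row Z i x y : x =1 y -> set_row Z i x = set_row Z i y.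
Proof. by move=> xy; apply/matrixP => j l; rewrite !mxE !xy. Qed.

Lemma set_row_id Z i : Z^T = Z -> set_row Z i (Z i) = Z.
Proof.
move=> Zs; apply/matrixP => j l; rewrite !mxE.
by case: eqP => [->|_] //; case: eqP => [->|_] //; rewrite -{1}Zs mxE.
Qed.

Lemma clique_weight_set_row Z i x T :
  i \notin T -> clique_weight (set_row Z i x) T = clique_weight Z T.
Proof.
move=> iT; apply: eq_bigr => -[j l] /= /and3P[jT lT _]; rewrite mxE.
by rewrite !ifN //; apply: contraNneq iT => <-.
Qed.

Lemma clique_weightU1 Z j T : Z^T = Z -> j \notin T ->
  clique_weight Z (j |: T) = clique_weight Z T * \prod_(l in T) Z j l.
Proof.
move=> Zs jT.
have wE S : clique_weight Z S =
    \prod_(i in S) \prod_(l in S | (i < l)%N) Z i l.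
  by rewrite pair_big_dep; apply: eq_bigl => -[i l]; rewrite /= andbA.
have wU i : \prod_(l in j |: T | (i < l)%N) Z i l =
    (if (i < j)%N then Z j i else 1) * \prod_(l in T | (i < l)%N) Z i l.
  rewrite big_mkcondr [in RHS]big_mkcondr big_setU1 //=.
  by rewrite -{1}Zs mxE.
rewrite !wE big_setU1 //= (eq_bigr _ (fun i _ => wU i)) big_split /= wU ltnn.
rewrite mul1r mulrA mulrC; congr (_ * _).
rewrite big_mkcondr -big_split /=; apply: eq_bigr => l lT.
case: (ltngtP j l) => [||/val_inj jl]; rewrite ?mulr1 ?mul1r //.
by rewrite jl lT in jT.
Qed.

(** Double counting: a clique of size m containing O is counted once for each
    of its m - |O| vertices outside O. *)
Lemma sum_pinned_partition m Z V O :
  \sum_(l in V :\: O) pinned_partition m Z V (l |: O) =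
  (m - #|O|)%:R * pinned_partition m Z V O.
Proof.
rewrite /pinned_partition mulr_sumr.
rewrite (exchange_big_dep
  (fun S => [&& O \subset S, S \subset V & #|S| == m])) /=.
  apply: eq_bigr => S /and3P[OS SV /eqP Sm].
  rewrite sumr_const mulr_natl; congr (_ *+ _).
  have -> : (m - #|O|)%N = #|S :\: O| by rewrite cardsD (setIidPr OS) Sm.
  apply: eq_card => l.
  rewrite [LHS]inE !inE subUset sub1set OS SV Sm eqxx !andbT.
  by case lS: (l \in S); rewrite ?andbF // (subsetP SV _ lS) !andbT.
move=> l S _; rewrite subUset => /and3P[/andP[_ ->] -> ->] //.
Qed.

Lemma pinned_partition_split m Z V O j :
  pinned_partition m Z V O =
  pinned_partition m Z (V :\ j) O + pinned_partition m Z V (j |: O).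
Proof.
rewrite /pinned_partition (bigID (fun S => j \notin S)) /=; congr (_ + _).
  apply: eq_bigl => S; rewrite subsetD1.
  by case: (_ \notin _); rewrite ?andbT ?andbF.
by apply: eq_bigl => S; rewrite subUset sub1set negbK [LHS]andbC -!andbA.
Qed.

(** The vertex j only contributes its row, evaluated on the rest of the clique.
    This is what makes the sum a product of affine functions of that row. *)
Lemma pinned_partitionU1 m Z V O j : Z^T = Z -> j \in V -> j \notin O ->
  pinned_partition m Z V (j |: O) =
  \sum_(T : {set 'I_n} | [&& O \subset T, T \subset V :\ j & #|T|.+1 == m])
    clique_weight Z T * \prod_(l in T) Z j l.
Proof.
move=> Zs jV jO; rewrite /pinned_partition.
rewrite (reindex_onto (fun T => j |: T) (fun S => S :\ j)) /=; last first.
  by move=> S /andP[]; rewrite subUset sub1set => /andP[jS _] _; rewrite setD1K.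
have cond T : ([&& j |: O \subset j |: T, j |: T \subset V & #|j |: T| == m]
     && ((j |: T) :\ j == T)) =
    [&& O \subset T, T \subset V :\ j & #|T|.+1 == m].
  case jT: (j \in T).
    rewrite subsetD1 jT /= !andbF; apply/andP=> -[_ /eqP] /setP/(_ j).
    by rewrite !inE eqxx jT.
  rewrite setU1K ?jT // eqxx andbT cardsU1 jT add1n.
  rewrite [X in [&& _, X & _]]subUset sub1set jV subsetD1 jT andbT /=.
  congr (_ && _); rewrite subUset sub1set !inE eqxx /=.
  rewrite -subDset (_ : O :\: [set j] = O) //; apply/setDidPl.
  by rewrite disjoint_sym disjoints1.
rewrite (eq_bigl _ _ cond); apply: eq_bigr => T /and3P[_ + _].
by rewrite subsetD1 => /andP[_ jT]; rewrite clique_weightU1.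
Qed.

Lemma pinned_partition_eq0 m Z V O :
  (m < #|O|)%N -> pinned_partition m Z V O = 0.
Proof.
move=> mO; rewrite /pinned_partition big_pred0 // => S; apply/negP.
by case/and3P=> /subset_leq_card + _ /eqP Sm; rewrite Sm leqNgt mO.
Qed.

Lemma pinned_partition_small m Z V O :
  (#|V| < m)%N -> pinned_partition m Z V O = 0.
Proof.
move=> Vm; rewrite /pinned_partition big_pred0 // => S; apply/negP.
by case/and3P=> _ /subset_leq_card + /eqP Sm; rewrite Sm leqNgt Vm.
Qed.

Lemma pinned_partition_full m Z V O :
  O \subset V -> #|O| = m -> pinned_partition m Z V O = clique_weight Z O.
Proof.
move=> OV Om; rewrite /pinned_partition (big_pred1 O) // => S /=.
apply/and3P/eqP => [[OS _ /eqP Sm]|->]; last by rewrite OV Om eqxx.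
by apply/esym/eqP; rewrite eqEcard OS Om Sm leqnn.
Qed.

Definition row_segment (a b : 'I_n -> K) (t : K) l := a l + t * (b l - a l).

(** The value of the partition function with i pinned while row i moves along
    the segment from a to b, as a polynomial in the time parameter. *)
Definition row_segment_poly m Z V O (a b : 'I_n -> K) : {poly K} :=
  \sum_(T : {set 'I_n} | [&& O \subset T, T \subset V & #|T|.+1 == m])
    (clique_weight Z T)%:P * \prod_(l in T) ((a l)%:P + (b l - a l) *: 'X).

Lemma horner_row_segment_poly m Z V O i a b t :
  Z^T = Z -> i \in V -> i \notin O ->
  (row_segment_poly m Z (V :\ i) O a b).[t] =
  pinned_partition m (set_row Z i (row_segment a b t)) V (i |: O).
Proof.
move=> Zs iV iO; rewrite pinned_partitionU1 ?set_row_sym //.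
rewrite horner_sum; apply: eq_bigr => T /and3P[_ + _].
rewrite subsetD1 => /andP[_ iT].
rewrite hornerM hornerC horner_prod clique_weight_set_row //; congr (_ * _).
by apply: eq_bigr => l _; rewrite !hornerE set_rowE mulrC.
Qed.

(** A clique through j avoiding i is worth the same as the clique obtained by
    substituting i for j, once i has been given the row of j. Hence comparing
    the pins i and j amounts to changing a single row. *)
Lemma pinned_partition_swap m Z V O i j :
  Z^T = Z -> i \in V -> j \in V -> i \notin O -> j \notin O -> i != j ->
  pinned_partition m (set_row Z i (Z j)) (V :\ j) (i |: O) =
  pinned_partition m Z (V :\ i) (j |: O).
Proof.
move=> Zs iV jV iO jO ij.
rewrite !pinned_partitionU1 ?set_row_sym ?inE ?iV ?jV ?ij // 1?eq_sym ?ij //.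
rewrite setDDl setUC -setDDl; apply: eq_bigr => T /and3P[_ + _].
rewrite subsetD1 => /andP[/subsetP iT _].
rewrite clique_weight_set_row; last by apply/negP => /iT; rewrite !inE eqxx.
by congr (_ * _); apply: eq_bigr => l _; rewrite set_rowE.
Qed.

End PinnedPartition.

Lemma horner_deriv_prod (K : fieldType) (I : Type) (r : seq I) (P : pred I)
    (p : I -> {poly K}) (t : K) : (forall l, P l -> (p l).[t] != 0) ->
  (\prod_(l <- r | P l) p l)^`().[t] =
  (\prod_(l <- r | P l) p l).[t] *
    \sum_(l <- r | P l) (p l)^`().[t] / (p l).[t].
Proof.
move=> p0; apply: (big_ind2 (fun x y => x^`().[t] = x.[t] * y)).
- by rewrite derivC horner0 mulr0.
- by move=> p1 y1 p2 y2 e1 e2; rewrite derivM hornerD !hornerM e1 e2; ring.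
- by move=> l Pl; rewrite mulrCA divff ?p0 // mulr1.
Qed.

(** Moving the entry at l only affects the cliques through l, so its partial
    derivative is the partition function with the additional pin l, divided by
    the entry. *)
Lemma horner_deriv_row_segment_poly (K : fieldType) n m (Z : 'M[K]_n)
    (V O : {set 'I_n}) i (a b : 'I_n -> K) t :
  Z^T = Z -> i \in V -> i \notin O ->
  (forall l, row_segment a b t l != 0) ->
  (row_segment_poly m Z (V :\ i) O a b)^`().[t] =
  \sum_(l in V :\ i) (b l - a l) / row_segment a b t l *
    pinned_partition m (set_row Z i (row_segment a b t)) V (l |: (i |: O)).
Proof.
move=> Zs iV iO x0; set Y := set_row _ _ _.
have Ys : Y^T = Y by apply: set_row_sym.
have xE l : ((a l)%:P + (b l - a l) *: 'X).[t] = row_segment a b t l.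
  by rewrite !hornerE mulrC.
transitivity (\sum_(T : {set 'I_n} |
    [&& O \subset T, T \subset V :\ i & #|T|.+1 == m])
    \sum_(l in T) (b l - a l) / row_segment a b t l *
      (clique_weight Z T * \prod_(j in T) row_segment a b t j)).
  rewrite (raddf_sum (@deriv K)) horner_sum /=; apply: eq_bigr => T _.
  rewrite derivM derivC mul0r add0r hornerM hornerC
    horner_deriv_prod; last first.
    by move=> l _; rewrite xE.
  rewrite horner_prod (eq_bigr _ (fun l _ => xE l)) mulrA mulrC mulr_suml.
  by apply: eq_bigr => l _; rewrite xE !derivE !hornerE.
rewrite (exchange_big_dep (mem (V :\ i))) /=; last first.
  by move=> T l /and3P[_ /subsetP TV _] /TV.
apply: eq_bigr => l lV; rewrite -mulr_sumr setUCA; congr (_ * _).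
have [li lV'] : l != i /\ l \in V by apply/andP; move: lV; rewrite !inE.
rewrite pinned_partitionU1 //; last by rewrite !inE negb_or eq_sym li.
apply: eq_big => [T|T /andP[/and3P[_ + _] _]].
  by rewrite subUset sub1set andbC -!andbA.
rewrite subsetD1 => /andP[_ iT]; rewrite clique_weight_set_row //.
by congr (_ * _); apply: eq_bigr => j _; rewrite set_rowE.
Qed.

(** * Plane geometry and growth of complex polynomials *)

Section ComplexPlane.
Variable R : rcfType.
Implicit Types (u v w z : R[i]) (t : R).

(** The real part of u times the conjugate of v. *)
Definition dot u v : R :=
  complex.Re u * complex.Re v + complex.Im u * complex.Im v.

Lemma dotDl u v w : dot (u + v) w = dot u w + dot v w.
Proof. by case: u v w => [a b] [c d] [e f]; rewrite /dot /=; ring. Qed.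

Lemma dotBl u v w : dot (u - v) w = dot u w - dot v w.
Proof. by case: u v w => [a b] [c d] [e f]; rewrite /dot /=; ring. Qed.

Lemma dotC u v : dot u v = dot v u.
Proof. by rewrite /dot mulrC [X in _ + X]mulrC. Qed.

Lemma dot0l v : dot 0 v = 0.
Proof. by rewrite /dot !mul0r addr0. Qed.

Lemma dot_suml (I : Type) (r : seq I) (P : pred I) (u : I -> R[i]) v :
  dot (\sum_(l <- r | P l) u l) v = \sum_(l <- r | P l) dot (u l) v.
Proof. by apply: (big_morph (dot^~ v)) => [x y|]; rewrite ?dotDl ?dot0l. Qed.

Lemma dot_sumr (I : Type) (r : seq I) (P : pred I) (u : I -> R[i]) v :
  dot v (\sum_(l <- r | P l) u l) = \sum_(l <- r | P l) dot v (u l).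
Proof. by rewrite dotC dot_suml; apply: eq_bigr => l _; rewrite dotC. Qed.

Lemma normc_ge0 u : 0 <= normc u.
Proof. by case: u => a b; apply: sqrtr_ge0. Qed.

Lemma dotvv u : dot u u = normc u ^+ 2.
Proof. by case: u => a b; rewrite /dot /= sqr_sqrtr ?addr_ge0 ?sqr_ge0. Qed.

Lemma ler_normcD u v : normc (u + v) <= normc u + normc v.
Proof. exact: (@le_normcD R). Qed.

Lemma normcB u v : normc (u - v) = normc (v - u).
Proof. by rewrite -[LHS](@normcN R) opprB. Qed.

Lemma normc_sum (I : Type) (r : seq I) (P : pred I) (u : I -> R[i]) :
  normc (\sum_(l <- r | P l) u l) <= \sum_(l <- r | P l) normc (u l).
Proof.
elim/big_rec2: _ => [|l y x _ xy]; first by rewrite (@normc0 R).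
by apply: le_trans (ler_normcD _ _) _; rewrite lerD2l.
Qed.

Lemma normc_real t : 0 <= t -> normc t%:C = t.
Proof. by move=> t0; rewrite /= expr0n addr0 sqrtr_sqr ger0_norm. Qed.

Lemma normc_eq0 u : (normc u == 0) = (u == 0).
Proof. by apply/eqP/eqP => [/eq0_normc|->] //; rewrite (@normc0 R). Qed.

Lemma normcB_sqr u v :
  normc (u - v) ^+ 2 = normc u ^+ 2 - 2 * dot u v + normc v ^+ 2.
Proof.
by rewrite -!dotvv dotBl ![dot _ (u - v)]dotC !dotBl [dot v u]dotC; ring.
Qed.

Lemma dot_le u v : dot u v <= normc u * normc v.
Proof.
have [|d0] := ltP (dot u v) 0.
  by move/ltW/le_trans; apply; rewrite mulr_ge0 ?normc_ge0.
rewrite -(@ler_pXn2r _ 2) ?nnegrE ?mulr_ge0 ?normc_ge0 // exprMn -!dotvv.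
case: u v d0 => [a b] [c d] _; rewrite /dot /=.
by have := sqr_ge0 (a * d - b * c); nra.
Qed.

(** No serious cancellation occurs between numbers that are pairwise close
    relatively to their moduli. If |x - y| is at most half of |x| and of |y|,
    then |x - y|^2 <= |x| |y| / 4, whence 2 dot x y >= (2 - 1/4) |x| |y|;
    summing over all pairs, |sum|^2 is at least 7/8 of the square of the sum of
    the moduli, and (37/40)^2 < 7/8. *)
Lemma sum_normc_le (I : finType) (A : {pred I}) (u : I -> R[i]) :
  (forall i j, i \in A -> j \in A -> 2 * normc (u i - u j) <= normc (u j)) ->
  37 / 40 * \sum_(i in A) normc (u i) <= normc (\sum_(i in A) u i).
Proof.
move=> close; set s := \sum_(i in A) _.
have s0 : 0 <= s by apply: sumr_ge0 => i _; apply: normc_ge0.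
rewrite -(@ler_pXn2r _ 2) ?nnegrE ?mulr_ge0 ?normc_ge0 ?invr_ge0 ?ler0n //.
apply: (@le_trans _ _ (7 / 8 * s ^+ 2)).
  by have := sqr_ge0 s; rewrite exprMn; nra.
rewrite -dotvv dot_suml expr2 {1}/s mulr_suml mulr_sumr; apply: ler_sum => i iA.
rewrite dot_sumr mulr_sumr mulr_sumr; apply: ler_sum => j jA.
have := normcB_sqr (u i) (u j).
have := close _ _ iA jA; have := close _ _ jA iA; rewrite normcB.
move: (normc_ge0 (u i)) (normc_ge0 (u j)) (normc_ge0 (u i - u j)).
move: (normc _) (normc (u i)) (normc (u j)) (dot _ _).
move=> d x y e x0 y0 d0 dx dy de.
have : (2 * d) * (2 * d) <= x * y by apply: ler_pM; lra.
by have := sqr_ge0 (x - y); nra.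
Qed.


Lemma dotMr_real u v t : dot u (v * t%:C) = dot u v * t.
Proof. by case: u v => [a b] [c d]; rewrite /dot /=; ring. Qed.

(** Projecting a complex polynomial on the direction u gives a real polynomial,
    to which the real mean value theorem applies. *)
Definition dot_poly u (F : {poly R[i]}) : {poly R} :=
  \poly_(k < size F) dot u F`_k.

Lemma coef_dot_poly u F k : (dot_poly u F)`_k = dot u F`_k.
Proof.
by rewrite coef_poly; case: ltnP => // /(nth_default 0) ->; rewrite dotC dot0l.
Qed.

Lemma horner_dot_poly u F t : (dot_poly u F).[t] = dot u F.[t%:C].
Proof.
rewrite horner_poly horner_coef dot_sumr; apply: eq_bigr => k _.
by rewrite -rmorphXn dotMr_real.
Qed.

Lemma deriv_dot_poly u F : (dot_poly u F)^`() = dot_poly u F^`().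
Proof.
apply/polyP => k; rewrite coef_deriv !coef_dot_poly coef_deriv.
by rewrite -mulr_natr -[in RHS]mulr_natr -dotMr_real rmorph_nat.
Qed.

(** A polynomial form of Gronwall's inequality |F(t)| <= |F(0)| exp(2t/5). On
    [0, 1], e(t) = 1 - 2t/5 + t^2/15 satisfies e' <= - (2/5) e, so |F|^2 e^2 is
    nonincreasing. The bound is then stated with
    G(t) = 1 + 2t/5 + t^2/10 >= 1/e(t). *)
Lemma normc_growth (F : {poly R[i]}) t :
  (forall s, 0 <= s -> s <= 1 ->
    normc F^`().[s%:C] <= 2 / 5 * normc F.[s%:C]) ->
  0 <= t -> t <= 1 ->
  normc F.[t%:C] <= normc F.[0] * (1 + 2 / 5 * t + 1 / 10 * t ^+ 2).
Proof.
move=> dF t0 t1.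
pose N := dot_poly 1 F ^+ 2 + dot_poly 'i F ^+ 2.
have NE s : N.[s] = normc F.[s%:C] ^+ 2.
  rewrite !hornerE !horner_dot_poly -dotvv.
  by case: (F.[_]) => a b; rewrite /dot /=; ring.
have dNE s : N^`().[s] = 2 * dot F.[s%:C] F^`().[s%:C].
  rewrite !derivE !deriv_dot_poly !hornerE !horner_dot_poly.
  by case: (F.[_]) (F^`().[_]) => [a b] [c d]; rewrite /dot /=; ring.
pose e : {poly R} := 1 - (2 / 5) *: 'X + (1 / 15) *: 'X^2.
have eE s : e.[s] = 1 - 2 / 5 * s + 1 / 15 * s ^+ 2 by rewrite !hornerE.
have deE s : e^`().[s] = - (2 / 5) + 2 / 15 * s.
  by rewrite !derivE !hornerE; ring.
have e0 s : 0 <= s -> s <= 1 -> 0 < e.[s] by rewrite eE => ? ?; nra.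
have dP (M f : {poly R}) s : (- (M * f ^+ 2))^`().[s] =
    f.[s] * (- (M^`().[s] * f.[s]) - 2 * M.[s] * f^`().[s]).
  by rewrite expr2 !derivE !hornerE /=; ring.
have decr : {in `[0, 1] &, {homo horner (- (N * e ^+ 2)) : x y / x <= y}}.
  apply: ler_hornerW => s /itvP sI.
  have [s0 s1] : 0 <= s /\ s <= 1 by rewrite !sI.
  rewrite dP; apply: mulr_ge0; first exact/ltW/e0.
  rewrite dNE NE deE; have := e0 _ s0 s1; rewrite eE => es.
  have := dot_le F.[s%:C] F^`().[s%:C]; have := dF _ s0 s1.
  move: (normc_ge0 F.[s%:C]) es.
  move: (normc F.[_]) (normc F^`().[_]) (dot _ _).
  move=> x y d x0 es yx dxy.
  have d2 : d <= 2 / 5 * x ^+ 2 by nra.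
  have : d * (1 - 2 / 5 * s + 1 / 15 * s ^+ 2) <=
         2 / 5 * x ^+ 2 * (1 - 2 / 5 * s + 1 / 15 * s ^+ 2).
    by apply: ler_wpM2r => //; apply: ltW.
  have : 0 <= x ^+ 2 * (s * (1 - s)).
    by rewrite mulr_ge0 ?sqr_ge0 // mulr_ge0 // subr_ge0.
  by lra.
have /decr : 0 \in `[0 : R, 1] by rewrite in_itv /= lexx ler01.
move=> /(_ t); rewrite in_itv /= t0 t1 => /(_ isT isT).
rewrite !hornerN lerN2 !hornerM -!expr2 !NE !eE mulr0 expr0n mulr0 subr0.
rewrite addr0 expr1n mulr1.
have := e0 _ t0 t1; rewrite eE.
move: (normc_ge0 F.[t%:C]) (normc_ge0 F.[0]).
move: (normc F.[_]) (normc F.[0]) => x y x0 y0 et xy.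
set E := _ + _ in et xy; set G := 1 + _ + _.
have xey : x * E <= y.
  rewrite -(@ler_pXn2r _ 2) ?nnegrE ?(mulr_ge0 x0 (ltW et)) //.
  by rewrite !expr2; lra.
(* G * E = 1 + t^2 (1 - t)^2 / 150 *)
have GE : 1 <= G * E.
  have : 0 <= t ^+ 2 * (1 - t) ^+ 2 by rewrite mulr_ge0 ?sqr_ge0.
  by rewrite /G /E; lra.
have G0 : 0 <= G by rewrite /G; nra.
have : x * 1 <= x * (G * E) by apply: ler_wpM2l.
have : x * E * G <= y * G by apply: ler_wpM2r.
by lra.
Qed.

(** Integrating |F'| <= (2/5) |F(0)| G over [0, 1] bounds the increment by
    (2/5 + 2/25 + 1/75) |F(0)| = (37/75) |F(0)|, which is less than half of
    |F(0)|. The integration is carried out on the component of F in the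
    direction of the increment. *)
Lemma normc_increment_le (F : {poly R[i]}) :
  (forall s, 0 <= s -> s <= 1 ->
    normc F^`().[s%:C] <= 2 / 5 * normc F.[s%:C]) ->
  2 * normc (F.[1] - F.[0]) <= normc F.[0].
Proof.
move=> dF; set c := F.[1] - F.[0].
pose p := (normc c * normc F.[0]) *:
    ((2 / 5) *: 'X + (2 / 25) *: 'X^2 + (1 / 75) *: 'X^3) - dot_poly c F.
have incr : {in `[0, 1] &, {homo horner p : x y / x <= y}}.
  apply: ler_hornerW => s /itvP sI.
  have [s0 s1] : 0 <= s /\ s <= 1 by rewrite !sI.
  rewrite /p !(derivE, derivXn) deriv_dot_poly !hornerE horner_dot_poly.
  rewrite subr_ge0; apply: le_trans (dot_le _ _) _.
  rewrite -mulrA; apply: ler_wpM2l; first exact: normc_ge0.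
  apply: le_trans (dF _ s0 s1) _.
  by have := normc_growth dF s0 s1; lra.
have := incr 0 1; rewrite !in_itv /= !lexx ler01 => /(_ isT isT isT).
rewrite /p !hornerE !horner_dot_poly /= -[0%:C]/(0 : R[i]) -[1%:C]/(1 : R[i]).
have : dot c F.[1] - dot c F.[0] = normc c ^+ 2.
  by rewrite ![dot c _]dotC -dotBl dotvv.
move: (normc_ge0 c) (normc_ge0 F.[0]).
move: (dot c F.[1]) (dot c F.[0]) (normc c) (normc F.[0]).
move=> d1 d0 x y x0 y0 e1 e2.
(* p(0) <= p(1) reads x^2 <= (37/75) x y *)
have [x00|x00] := eqVneq x 0; first by rewrite x00 mulr0.
have xp : 0 < x by rewrite lt_def x00.
rewrite -(ler_pM2l xp); move: e1 e2; have := mulr_ge0 x0 y0; lra.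
Qed.

End ComplexPlane.

(** * The zero-free region *)

Section ZeroFree.
Variables (R : rcfType) (n m : nat) (delta : R).
Hypothesis delta_lt1 : delta < 1.
(** An entry z and its replacement z' in the disc of radius delta satisfy
    |z' - z| / |z| <= 2 delta / (1 - delta), and a clique has m - 1 entries in
    a row. Since (37/100) / (37/40) = 2/5, this bound on the total relative
    variation matches the loss in the sector lemma and the rate in Gronwall's
    inequality. *)
Hypothesis delta_small :
  2 * delta * (m%:R - 1) <= 37 / 100 * (1 - delta).
Implicit Types (Z : 'M[R[i]]_n) (V O : {set 'I_n}) (i j l : 'I_n) (t : R).

Local Notation P := (pinned_partition m).

Definition near1 (x : 'I_n -> R[i]) := forall l, normc (x l - 1) <= delta.

Lemma near1_ge (x : 'I_n -> R[i]) l : near1 x -> 1 - delta <= normc (x l).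
Proof.
move=> /(_ l) xl; have := ler_normcD (x l) (1 - x l).
by rewrite addrC subrK (@normc1 R) normcB; lra.
Qed.

Lemma near1_neq0 (x : 'I_n -> R[i]) l : near1 x -> x l != 0.
Proof.
move=> /(near1_ge l) xl; rewrite -normc_eq0 gt_eqF //.
by have := delta_lt1; lra.
Qed.

Lemma near1_row_segment (a b : 'I_n -> R[i]) t :
  near1 a -> near1 b -> 0 <= t -> t <= 1 -> near1 (row_segment a b t%:C).
Proof.
move=> an bn t0 t1 l.
have -> : row_segment a b t%:C l - 1 =
    (1 - t)%:C * (a l - 1) + t%:C * (b l - 1).
  by rewrite /row_segment rmorphB rmorph1; ring.
apply: le_trans (ler_normcD _ _) _.
rewrite !(@normcM R) !normc_real ?subr_ge0 //.
by have := an l; have := bn l; nra.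
Qed.

Lemma near1_set_row Z i (x : 'I_n -> R[i]) :
  (forall j, near1 (Z j)) -> near1 x -> forall j, near1 (set_row Z i x j).
Proof. by move=> Zn xn j l; rewrite mxE; do 2?case: ifP => _ //; apply: Zn. Qed.

(** The induction hypothesis: replacing one pin by another changes the value by
    at most half of its modulus. *)
Definition pins_close k := forall Z V O i j,
  Z^T = Z -> (forall i, near1 (Z i)) -> #|O| = k ->
  i \in V :\: O -> j \in V :\: O ->
  2 * normc (P Z V (i |: O) - P Z V (j |: O)) <= normc (P Z V (j |: O)).

(** The hypothesis on pins makes the terms of the double counting identity
    pairwise close, so the sum is comparable to the sum of the moduli. *)
Lemma pins_sector Z V O : pins_close #|O| ->
  Z^T = Z -> (forall i, near1 (Z i)) ->
  37 / 40 * \sum_(l in V :\: O) normc (P Z V (l |: O)) <=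
  (m - #|O|)%:R * normc (P Z V O).
Proof.
move=> cl Zs Zn.
have -> : (m - #|O|)%:R * normc (P Z V O) =
    normc (\sum_(l in V :\: O) P Z V (l |: O)).
  rewrite sum_pinned_partition (@normcM R) -(rmorph_nat (real_complex R)).
  by rewrite normc_real ?ler0n.
by apply: sum_normc_le => i j iV jV; apply: cl.
Qed.

(** The sum to be controlled is the one in the derivative along a row. The
    vertices of O other than i give |O| - 1 copies of the same value, the
    others at most 40/37 times m - |O| copies. *)
Lemma sum_pins_le Z V O i : pins_close #|O| ->
  Z^T = Z -> (forall i, near1 (Z i)) -> i \in O -> (#|O| <= m)%N ->
  37 / 40 * \sum_(l in V :\ i) normc (P Z V (l |: O)) <=
  (m%:R - 1) * normc (P Z V O).
Proof.
move=> cl Zs Zn iO Om; have := pins_sector V cl Zs Zn.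
rewrite [in X in _ -> X](bigID (mem O)) /=.
have -> : \sum_(l in V :\ i | l \notin O) normc (P Z V (l |: O)) =
          \sum_(l in V :\: O) normc (P Z V (l |: O)).
  apply: eq_bigl => l; rewrite !inE andbC.
  by case: (eqVneq l i) => [->|]; rewrite ?iO.
have : \sum_(l in V :\ i | l \in O) normc (P Z V (l |: O)) <=
       (#|O|%:R - 1) * normc (P Z V O).
  rewrite (eq_bigr (fun=> normc (P Z V O))); last first.
    by move=> l /andP[_ lO]; rewrite (setUidPr _) ?sub1set.
  rewrite sumr_const -[leLHS]mulr_natl.
  apply: ler_wpM2r; first exact: normc_ge0.
  rewrite lerBrDr natr1 ler_nat (cardsD1 i O) iO add1n ltnS.
  apply: subset_leq_card; apply/subsetP => l /andP[].
  by rewrite !inE => /andP[-> _] ->.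
rewrite natrB //; have := normc_ge0 (P Z V O).
have : 1 <= #|O|%:R :> R by rewrite ler1n card_gt0; apply/set0Pn; exists i.
by nra.
Qed.

(** Along the segment from a to b the modulus of the derivative is at most 2/5
    of that of the value, by the bound on the sum over additional pins. *)
Lemma change_row Z V O i (a b : 'I_n -> R[i]) : pins_close #|O|.+1 ->
  Z^T = Z -> (forall i, near1 (Z i)) -> near1 a -> near1 b ->
  i \in V -> i \notin O -> (#|O| < m)%N ->
  2 * normc (P (set_row Z i b) V (i |: O) - P (set_row Z i a) V (i |: O)) <=
  normc (P (set_row Z i a) V (i |: O)).
Proof.
move=> cl Zs Zn an bn iV iO Om.
pose F := row_segment_poly m Z (V :\ i) O a b.
have FE t : F.[t%:C] = P (set_row Z i (row_segment a b t%:C)) V (i |: O).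
  exact: horner_row_segment_poly.
have <- : F.[1] = P (set_row Z i b) V (i |: O).
  rewrite (FE 1); congr (P _ _ _); apply: eq_set_row => l.
  by rewrite /row_segment mul1r addrC subrK.
have <- : F.[0] = P (set_row Z i a) V (i |: O).
  rewrite (FE 0); congr (P _ _ _); apply: eq_set_row => l.
  by rewrite /row_segment mul0r addr0.
apply: normc_increment_le => t t0 t1; rewrite FE.
have xn := near1_row_segment an bn t0 t1.
set x := row_segment _ _ _ in xn *.
have cardO : #|i |: O| = #|O|.+1 by rewrite cardsU1 iO.
have := @sum_pins_le (set_row Z i x) V (i |: O) i.
rewrite cardO setU11.
move=> /(_ cl (set_row_sym _ _ Zs) (near1_set_row i Zn xn) isT Om).
rewrite horner_deriv_row_segment_poly //; last by move=> l; apply: near1_neq0.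
rewrite -/x; set Y := set_row Z i x; set p := normc (P Y V (i |: O)).
set s := \sum_(l in _) normc _ => sp.
have p0 : 0 <= p by apply: normc_ge0.
have d1 : 0 < 1 - delta by rewrite subr_gt0.
have : normc (\sum_(l in V :\ i) (b l - a l) / x l * P Y V (l |: (i |: O))) <=
       2 * delta / (1 - delta) * s.
  apply: le_trans (normc_sum _ _ _) _; rewrite mulr_sumr.
  apply: ler_sum => l _; rewrite (@normcM R); apply: ler_wpM2r.
    exact: normc_ge0.
  rewrite (@normcM R) (@normcV R); apply: ler_pM.
  - exact: normc_ge0.
  - by rewrite invr_ge0 normc_ge0.
  - rewrite (_ : b l - a l = (b l - 1) + (1 - a l)); last by ring.
    apply: le_trans (ler_normcD _ _) _; rewrite [normc (1 - _)]normcB.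
    by have := an l; have := bn l; lra.
  - rewrite lef_pV2 ?posrE //; first exact: near1_ge.
    exact: lt_le_trans (near1_ge _ xn).
move/le_trans; apply; rewrite mulrAC ler_pdivrMr //.
have delta0 : 0 <= delta by apply: le_trans (an i); apply: normc_ge0.
have : 2 * delta * (37 / 40 * s) <= 2 * delta * ((m%:R - 1) * p).
  by apply: ler_wpM2l => //; lra.
have : 2 * delta * (m%:R - 1) * p <= 37 / 100 * (1 - delta) * p.
  exact: ler_wpM2r.
by lra.
Qed.

(** Write the whole value as A + B, with B the contribution of the cliques
    through i, which may be assumed nonzero. By double counting, A + B is
    N / M >= 1 times an average of values within |B| / 2 of B, where N counts
    the vertices available and M those still to be chosen; hence
    2 dot (A + B) B >= |B|^2, which says that |A| <= |A + B|. *)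
Lemma avoid_pin_le Z V O i : pins_close #|O| ->
  Z^T = Z -> (forall i, near1 (Z i)) -> i \in V :\: O ->
  normc (P Z (V :\ i) O) <= normc (P Z V O).
Proof.
move=> cl Zs Zn iV; rewrite (pinned_partition_split m Z V O i).
set A := P Z (V :\ i) O; set B := P Z V (i |: O).
have [B0|B0] := eqVneq B 0; first by rewrite B0 addr0.
have Vm : (m <= #|V|)%N.
  rewrite leqNgt; apply: contraNN B0 => Vm.
  by rewrite /B pinned_partition_small.
have Om : (#|O| < m)%N.
  rewrite ltnNge; apply: contraNN B0 => Om; rewrite /B pinned_partition_eq0 //.
  by move: iV; rewrite inE cardsU1 => /andP[-> _].
suff : normc B ^+ 2 <= 2 * dot (A + B) B.
  have := normcB_sqr (A + B) B; rewrite addrK => e le.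
  rewrite -(@ler_pXn2r _ 2) ?nnegrE ?normc_ge0 //; lra.
have e : (m - #|O|)%:R * dot (A + B) B =
    \sum_(l in V :\: O) dot (P Z V (l |: O)) B.
  rewrite -dot_suml sum_pinned_partition (pinned_partition_split m Z V O i).
  rewrite -(rmorph_nat (real_complex R)) [in RHS]dotC mulrC.
  by rewrite [in RHS]mulrC dotMr_real dotC mulrC.
have : #|V :\: O|%:R * (1 / 2 * normc B ^+ 2) <= (m - #|O|)%:R * dot (A + B) B.
  rewrite e mulr_natl -sumr_const; apply: ler_sum => l lV.
  have := cl _ _ _ l i Zs Zn erefl lV iV; rewrite -/B.
  have := dot_le (B - P Z V (l |: O)) B; rewrite dotBl dotvv normcB.
  by have := normc_ge0 B; nra.
have MN : (m - #|O|)%:R <= #|V :\: O|%:R :> R.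
  rewrite ler_nat cardsD; apply: leq_sub => //.
  exact: subset_leq_card (subsetIr _ _).
have M0 : 0 < (m - #|O|)%:R :> R by rewrite ltr0n subn_gt0.
move=> le; rewrite -(ler_pM2l M0); have := sqr_ge0 (normc B); nra.
Qed.

(** The cliques containing both pins i and j contribute equally to the two
    values. The remaining parts differ by a change of one row, and the part
    without i is no larger than the whole value for the pin j. *)
Lemma pins_close_step k : (k < m)%N -> pins_close k.+1 -> pins_close k.
Proof.
move=> km cl Z V O i j Zs Zn Ok iVO jVO.
have [->|ij] := eqVneq i j.
  by rewrite subrr (@normc0 R) mulr0 normc_ge0.
move: (iVO) (jVO); rewrite !inE => /andP[iO iV] /andP[jO jV].
have cardO : #|j |: O| = k.+1 by rewrite cardsU1 jO Ok.
have iVO' : i \in V :\: (j |: O) by rewrite !inE negb_or ij iO.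
have le := @avoid_pin_le Z V (j |: O) i.
rewrite cardO in le; have {}le := le cl Zs Zn iVO'.
apply: le_trans le.
rewrite (pinned_partition_split m Z V (i |: O) j).
rewrite (pinned_partition_split m Z V (j |: O) i) [i |: (j |: O)]setUCA.
rewrite opprD addrACA subrr addr0 -pinned_partition_swap 1?eq_sym //.
have := @change_row Z (V :\ i) O j (Z j) (Z i); rewrite Ok set_row_id //.
by apply; rewrite // !inE jV eq_sym ij.
Qed.

(** With m vertices pinned already, no clique of size m contains one more. *)
Lemma pins_close_ge k : (m <= k)%N -> pins_close k.
Proof.
move=> mk Z V O i j _ _ Ok; rewrite !inE => /andP[iO _] /andP[jO _].
rewrite !pinned_partition_eq0 ?cardsU1 ?iO ?jO ?Ok //.
by rewrite subrr (@normc0 R) mulr0.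
Qed.

Lemma all_pins_close k : pins_close k.
Proof.
elim: {k}(m - k)%N {-2}k (leqnn (m - k)) => [|d IH] k kd.
  by apply: pins_close_ge; rewrite -subn_eq0 -leqn0.
have [mk|km] := leqP m k; first exact: pins_close_ge.
apply: pins_close_step => //; apply: IH.
by rewrite subnS -ltnS prednK ?subn_gt0.
Qed.

(** By descending induction on the number of pins: the sector lemma bounds the
    value from below by a multiple of any value with one more pin, down to the
    weight of a single clique. *)
Lemma pinned_partition_neq0 Z V O :
  Z^T = Z -> (forall i, near1 (Z i)) ->
  O \subset V -> (#|O| <= m <= #|V|)%N -> P Z V O != 0.
Proof.
move=> Zs Zn; elim: {O}(m - #|O|)%N {-2}O (erefl (m - #|O|)%N) => [|d IH] O.
  move/eqP; rewrite subn_eq0 => mO OV /andP[Om _].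
  have Oe : #|O| = m by apply/eqP; rewrite eqn_leq Om.
  rewrite pinned_partition_full //; apply/prodf_neq0 => -[i j] _.
  exact: near1_neq0.
move=> Od OV /andP[Om mV].
have Om' : (#|O| < m)%N by rewrite -subn_gt0 Od.
have /set0Pn[i iV] : V :\: O != set0.
  rewrite setD_eq0; apply/negP => /subset_leq_card VO.
  by move: (leq_trans mV VO); rewrite leqNgt Om'.
have := iV; rewrite inE => /andP[iO iV'].
have : P Z V (i |: O) != 0.
  apply: IH.
  - by rewrite cardsU1 iO add1n subnS Od.
  - by rewrite subUset sub1set iV'.
  - by rewrite cardsU1 iO add1n Om'.
apply: contraNneq => PO0; rewrite -normc_eq0 eq_le normc_ge0 andbT.
have := @pins_sector Z V O (@all_pins_close _) Zs Zn.
rewrite PO0 (@normc0 R) mulr0.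
rewrite (bigD1 i) //=.
have : 0 <= \sum_(l in V :\: O | l != i) normc (P Z V (l |: O)).
  by apply: sumr_ge0 => l _; apply: normc_ge0.
by lra.
Qed.

End ZeroFree.

(** The numerical condition holds for omega = 61/1000 as soon as m >= 2, and
    for omega = 181/1000 when m >= 10: then 2 omega = 0.362, while
    (37/100) (1 - 181/9000) > 0.3625. *)
Lemma clique_partition_neq0 (R : rcfType) (n m : nat) (omega : R)
    (Z : 'M[R[i]]_n) :
  (1 < m)%N -> (m <= n)%N -> omega < m%:R - 1 ->
  2 * omega <= 37 / 100 * (1 - omega / (m%:R - 1)) ->
  Z^T = Z ->
  (forall i j : 'I_n, `|Z i j - 1| <= (omega / (m%:R - 1))%:C) ->
  clique_partition m Z != 0.
Proof.
move=> m1 mn om1 om2 Zs Zn.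
have m0 : 0 < m%:R - 1 :> R by rewrite subr_gt0 ltr1n.
have -> : clique_partition m Z = pinned_partition m Z [set: 'I_n] set0.
  by apply: eq_bigl => S; rewrite sub0set subsetT.
apply: (@pinned_partition_neq0 R n m (omega / (m%:R - 1))) => //.
- by rewrite ltr_pdivrMr // mul1r.
- by rewrite -mulrA divfK // gt_eqF.
- by move=> i l; have := Zn i l; rewrite -lecR.
- by rewrite cards0 cardsT card_ord.
Qed.

Theorem theorem1p5 (R : realType) :
  [/\ exists omega : R, 0 < omega /\
        forall (m n : nat) (Z : 'M[R[i]]_n),
          (1 < m)%N -> (m <= n)%N -> Z^T = Z ->
          (forall i j : 'I_n, `|Z i j - 1| <= (omega / (m%:R - 1))%:C) ->
          clique_partition m Z != 0,
      forall (m n : nat) (Z : 'M[R[i]]_n),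
        (1 < m)%N -> (m <= n)%N -> Z^T = Z ->
        (forall i j : 'I_n, `|Z i j - 1| <= ((61 / 1000) / (m%:R - 1))%:C) ->
        clique_partition m Z != 0
    & forall (m n : nat) (Z : 'M[R[i]]_n),
        (1 < m)%N -> (m <= n)%N -> (10 <= m)%N -> (4 * m <= n)%N -> Z^T = Z ->
        (forall i j : 'I_n, `|Z i j - 1| <= ((181 / 1000) / (m%:R - 1))%:C) ->
        clique_partition m Z != 0].
Proof.
have small (m n : nat) (Z : 'M[R[i]]_n) :
    (1 < m)%N -> (m <= n)%N -> Z^T = Z ->
    (forall i j : 'I_n, `|Z i j - 1| <= ((61 / 1000) / (m%:R - 1))%:C) ->
    clique_partition m Z != 0.
  move=> m1 mn; have m2 : 2 <= m%:R :> R by rewrite ler_nat.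
  have : 61 / 1000 / (m%:R - 1) <= 61 / 1000 :> R.
    by rewrite ler_pdivrMr; lra.
  by move=> le; apply: clique_partition_neq0 => //; lra.
split=> [|//|m n Z m1 mn m10 _].
  by exists (61 / 1000); split=> //; lra.
have m10R : 10 <= m%:R :> R by rewrite ler_nat.
have : 181 / 1000 / (m%:R - 1) <= 181 / 9000 :> R.
  by rewrite ler_pdivrMr; lra.
by move=> le; apply: clique_partition_neq0 => //; lra.
Qed.
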